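(* For each $\varepsilon>0$ there exists an increasing sequence of positive integers $\mathcal{N}=(n_j)_{j\ge1}$ whose counting function satisfies $N(x)=x+O(x^{1/2+\varepsilon})$ and for which $\mathrm{LH}(\mathcal{N},x)$ fails.
   Context: $N(x)=\#\{j:n_j\le x\}$. For a differentiable $M$, $\mathrm{LH}(\mathcal{N},M(x))$ means: for every $\varepsilon'>0$ and $B>0$ there is $C=C(\varepsilon',B)$ with $\bigl|\sum_{n_j\le x}n_j^{-\mathrm{i} t}-\int_{n_1}^x u^{-\mathrm{i} t}M'(u)\,\mathrm{d}u\bigr|\le C M(x)^{1/2}|t|^{\varepsilon'}$ for all real $t$ and $n_1\le x\le|t|^B$. Here $M(x)=x$. *)

(* Defs.v *)
From Stdlib Require Import Reals Lra Lia List ZArith.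
From Coquelicot Require Import Coquelicot.
Open Scope R_scope.

(* Sequences are indexed from 0, so [n 0%nat] is the first term n_1. *)
Definition increasing_pos (n : nat -> nat) : Prop :=
  (0 < n 0)%nat /\ (forall j, (n j < n (S j))%nat).

(* The indices j with n_j <= x.  The search is cut off at j < up x, which loses
   nothing for an increasing sequence since then j < n_j; see [In_indices]. *)
Definition indices (n : nat -> nat) (x : R) : list nat :=
  filter (fun j => if Rle_dec (INR (n j)) x then true else false)
         (seq 0 (Z.to_nat (up x))).

Lemma NoDup_indices (n : nat -> nat) (x : R) : NoDup (indices n x).
Proof. apply NoDup_filter, seq_NoDup. Qed.

Lemma increasing_pos_gt (n : nat -> nat) :
  increasing_pos n -> forall j, (j < n j)%nat.
Proof.
  intros [H0 HS] j; induction j as [|j IH]; [exact H0|].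
  specialize (HS j); lia.
Qed.

Lemma In_indices (n : nat -> nat) (x : R) (j : nat) :
  increasing_pos n -> (In j (indices n x) <-> INR (n j) <= x).
Proof.
  intros Hn; unfold indices; rewrite filter_In, in_seq.
  destruct (Rle_dec (INR (n j)) x) as [Hx|Hx]; split; intros H;
    try (destruct H; discriminate); try easy.
  split; [|reflexivity].
  pose proof (lt_INR _ _ (increasing_pos_gt n Hn j)) as Hj.
  destruct (archimed x) as [Hup _].
  assert (Hz : IZR (Z.of_nat j) < IZR (up x)) by (rewrite <- INR_IZR_INZ; lra).
  apply lt_IZR in Hz; lia.
Qed.

Definition counting (n : nat -> nat) (x : R) : R := INR (length (indices n x)).

(* u^(-it) = exp (-it ln u) for u > 0 *)
Definition pow_mit (t u : R) : C := (cos (t * ln u), - sin (t * ln u)).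

(* [Rpower 0 y] is 1; here 0^y = 0, as it should be for y > 0. *)
Definition rpow (x y : R) : R := if Rlt_dec 0 x then Rpower x y else 0.

Definition exp_sum (n : nat -> nat) (t x : R) : C :=
  fold_right Cplus (RtoC 0) (map (fun j => pow_mit t (INR (n j))) (indices n x)).

Definition exp_int (M : R -> R) (t a x : R) : C :=
  @RInt C_R_CompleteNormedModule
    (fun u => Cmult (pow_mit t u) (RtoC (Derive M u))) a x.

Definition LH (n : nat -> nat) (M : R -> R) : Prop :=
  forall eps' B : R, 0 < eps' -> 0 < B ->
  exists K : R, forall t x : R,
    INR (n 0%nat) <= x <= rpow (Rabs t) B ->
    Cmod (Cminus (exp_sum n t x) (exp_int M t (INR (n 0%nat)) x))
      <= K * sqrt (M x) * rpow (Rabs t) eps'.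

(* Main.v *)
Require Import Defs.
From Stdlib Require Import Reals.
From Coquelicot Require Import Coquelicot.
From Stdlib Require Import Lra Lia List ZArith Permutation.
Open Scope R_scope.

(** [LH] forces short gaps.  Across a gap [n_j <= x < n_(j+1)] the exponential
    sum does not change, whereas for [t = n_j / (x - n_j)] the phase [t ln u]
    moves by at most 1, so that the integral of [u^(-it)] changes by at least
    [(x - n_j) / 2].  Hence [LH] bounds the gap after [n_j] by [n_j^(1/2+d)] for
    every [d > 0] and all large [j].  A sequence that runs through the integers
    but skips about [P^(1/2+e)] of them at each power [P] of 2 violates this for
    [d < e], and yet it satisfies [N(x) = x + O(x^(1/2+e))], since the gap
    lengths grow geometrically. *)

Lemma Rpower_eventually_gt (s C : R) : 0 < s ->
  exists y0, forall y, y0 <= y -> C < Rpower y s.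
Proof.
  intros Hs; exists (Rpower (Rabs C + 1) (/ s)); intros y Hy.
  pose proof (Rabs_pos C) as HC.
  apply Rlt_le_trans with (Rpower (Rpower (Rabs C + 1) (/ s)) s).
  - rewrite Rpower_mult, Rinv_l, Rpower_1 by lra; pose proof (Rle_abs C); lra.
  - apply Rle_Rpower_l; [lra|split; [apply exp_pos|exact Hy]].
Qed.

Lemma INR_to_nat_Zfloor (r : R) : 0 <= r ->
  INR (Z.to_nat (Zfloor r)) <= r < INR (Z.to_nat (Zfloor r)) + 1.
Proof.
  intros Hr; rewrite INR_IZR_INZ, Z2Nat.id by (apply Zfloor_lub, Hr).
  apply Zfloor_bound.
Qed.

Lemma cos_ge_half (th : R) : Rabs th <= PI / 3 -> 1 / 2 <= cos th.
Proof.
  intros Hth; pose proof PI_RGT_0 as HPI; pose proof (Rabs_pos th) as Hth0.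
  replace (cos th) with (cos (Rabs th))
    by (unfold Rabs; destruct (Rcase_abs th); [apply cos_neg|reflexivity]).
  rewrite <- cos_PI3; apply cos_decr_1; lra.
Qed.

Lemma ln_sub_le (a u : R) : 0 < a -> 0 < u -> ln u - ln a <= (u - a) / a.
Proof.
  intros Ha Hu; rewrite <- ln_div by assumption.
  assert (Hq : 0 < u / a) by (apply Rdiv_lt_0_compat; assumption).
  pose proof (exp_ineq1_le (ln (u / a))) as H; rewrite exp_ln in H by exact Hq.
  replace ((u - a) / a) with (u / a - 1) by (field; lra); lra.
Qed.

Lemma Permutation_fold_right {A B : Type} (f : A -> B -> B) (b : B)
  (l l' : list A) :
  (forall x y z, f x (f y z) = f y (f x z)) -> Permutation l l' ->
  fold_right f b l = fold_right f b l'.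
Proof.
  intros Hf Hl; induction Hl as [|x l l' _ IH|x y l|l l' l'' _ IH _ IH']; simpl.
  - reflexivity.
  - now rewrite IH.
  - apply Hf.
  - now rewrite IH.
Qed.

Definition gap (n : nat -> nat) (j : nat) : R := INR (n (S j)) - INR (n j).

Section IncreasingSequence.

Variable n : nat -> nat.
Hypothesis n_increasing : increasing_pos n.

Lemma INR_increasing_pos_le (i j : nat) : (i <= j)%nat -> INR (n i) <= INR (n j).
Proof.
  destruct n_increasing as [_ HS]; intros Hij; apply le_INR.
  induction Hij as [|j _ IH]; [lia|]; specialize (HS j); lia.
Qed.

Lemma INR_increasing_pos_ge_1 (j : nat) : 1 <= INR (n j).
Proof.
  destruct n_increasing as [H0 _].
  apply Rle_trans with (INR (n 0)); [|apply INR_increasing_pos_le; lia].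
  apply (le_INR 1), H0.
Qed.

Lemma increasing_pos_exists_between (x : R) : INR (n 0%nat) <= x ->
  exists j, INR (n j) <= x < INR (n (S j)).
Proof.
  intros H0; destruct (INR_unbounded x) as [m Hm].
  pose proof (lt_INR _ _ (increasing_pos_gt n n_increasing m)) as Hnm.
  assert (Hx : x < INR (n m)) by lra; clear Hm Hnm.
  induction m as [|m IH]; [lra|].
  destruct (Rlt_dec x (INR (n m))) as [Hxm|Hxm]; [auto|].
  exists m; lra.
Qed.

Lemma Permutation_indices_between (x : R) (j : nat) :
  INR (n j) <= x < INR (n (S j)) -> Permutation (indices n x) (seq 0 (S j)).
Proof.
  intros Hx; apply NoDup_Permutation; [apply NoDup_indices|apply seq_NoDup|].
  intros i; rewrite (In_indices n x i n_increasing), in_seq; split; intros Hi.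
  - destruct (le_lt_dec (S j) i) as [Hij|Hij]; [|lia].
    apply INR_increasing_pos_le in Hij; lra.
  - pose proof (INR_increasing_pos_le i j ltac:(lia)); lra.
Qed.

Lemma counting_between (x : R) (j : nat) :
  INR (n j) <= x < INR (n (S j)) -> counting n x = INR (S j).
Proof.
  intros Hx; unfold counting.
  rewrite (Permutation_length (Permutation_indices_between x j Hx)), length_seq.
  reflexivity.
Qed.

Lemma exp_sum_between (t x : R) (j : nat) :
  INR (n j) <= x < INR (n (S j)) -> exp_sum n t x = exp_sum n t (INR (n j)).
Proof.
  intros Hx; unfold exp_sum; apply Permutation_fold_right.
  - intros z z' z''; ring.
  - apply Permutation_map.
    rewrite (Permutation_indices_between x j Hx).
    symmetry; apply Permutation_indices_between; lra.
Qed.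

End IncreasingSequence.

Lemma Cmod_pow_mit (t u : R) : Cmod (pow_mit t u) = 1.
Proof.
  unfold Cmod, pow_mit; simpl fst; simpl snd.
  rewrite <- sqrt_1, <- (sin2_cos2 (t * ln u)); unfold Rsqr; f_equal; ring.
Qed.

Lemma continuous_C_pair (f g : R -> R) (u : R) :
  continuous f u -> continuous g u ->
  continuous (U := C_R_NormedModule) (fun v => (f v, g v)) u.
Proof.
  intros Hf Hg.
  apply (filterlim_locally (U := C_R_NormedModule)); intros eps.
  pose proof (proj1 (filterlim_locally f (f u)) Hf eps) as Hfeps.
  pose proof (proj1 (filterlim_locally g (g u)) Hg eps) as Hgeps.
  apply (filter_and _ _ Hfeps Hgeps).
Qed.

Lemma continuous_pow_mit (t u : R) : 0 < u ->
  continuous (U := C_R_NormedModule) (pow_mit t) u.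
Proof.
  intros Hu; apply continuous_C_pair;
    apply (ex_derive_continuous (V := R_NormedModule)); auto_derive; exact Hu.
Qed.

Lemma Re_pow_mit_rotation (t a u r : R) :
  Re (Cmult (pow_mit (- t) a) (Cmult (pow_mit t u) (RtoC r))) =
  cos (t * (ln u - ln a)) * r.
Proof.
  rewrite Rmult_minus_distr_l, cos_minus; simpl.
  rewrite Ropp_mult_distr_l_reverse, cos_neg, sin_neg; ring.
Qed.

Lemma cos_phase_ge_half (t a u : R) :
  0 < a <= u -> Rabs t * (u - a) <= a -> 1 / 2 <= cos (t * (ln u - ln a)).
Proof.
  intros [Ha Hu] Hphase; apply cos_ge_half; rewrite Rabs_mult.
  pose proof (ln_le a u Ha Hu) as Hln.
  rewrite (Rabs_pos_eq (ln u - ln a)) by lra.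
  apply Rle_trans with 1; [|pose proof PI2_3_2; lra].
  apply Rle_trans with (Rabs t * ((u - a) / a)).
  - apply Rmult_le_compat_l; [apply Rabs_pos|apply ln_sub_le; lra].
  - unfold Rdiv; rewrite <- Rmult_assoc; apply Rle_div_l; lra.
Qed.

Lemma is_RInt_le_Cmod (f : R -> C) (g : R -> R) (w I : C) (J a b : R) :
  a <= b -> Cmod w = 1 ->
  is_RInt (V := C_R_NormedModule) f a b I -> is_RInt g a b J ->
  (forall u, a < u < b -> g u <= Re (Cmult w (f u))) -> J <= Cmod I.
Proof.
  intros Hab Hw Hf Hg Hle.
  assert (Hwf : is_RInt (fun u => Re (Cmult w (f u))) a b (Re (Cmult w I))).
  { apply (is_RInt_minus (V := R_NormedModule)
      (fun u => Re w * Re (f u)) (fun u => Im w * Im (f u)));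
      apply (is_RInt_scal (V := R_NormedModule)).
    - apply (is_RInt_fct_extend_fst (U := R_NormedModule) (V := R_NormedModule)).
      exact Hf.
    - apply (is_RInt_fct_extend_snd (U := R_NormedModule) (V := R_NormedModule)).
      exact Hf. }
  apply Rle_trans with (1 := is_RInt_le _ _ _ _ _ _ Hab Hg Hwf Hle).
  apply Rle_trans with (1 := Rle_abs _), Rle_trans with (1 := re_le_Cmod _).
  rewrite Cmod_mult, Hw; lra.
Qed.

Section ExponentialIntegral.

Variable M : R -> R.
Hypothesis M_derivable : forall u, 0 < u -> ex_derive M u.
Hypothesis Derive_M_continuous : forall u, 0 < u -> continuous (Derive M) u.
Hypothesis Derive_M_nonneg : forall u, 0 < u -> 0 <= Derive M u.

Lemma is_RInt_Derive_pos (a b : R) : 0 < a -> 0 < b ->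
  is_RInt (Derive M) a b (M b - M a).
Proof.
  intros Ha Hb; pose proof (Rmin_glb_lt a b 0 Ha Hb) as Hmin.
  apply (is_RInt_derive (V := R_CompleteNormedModule)); intros u Hu.
  - apply Derive_correct, M_derivable; lra.
  - apply Derive_M_continuous; lra.
Qed.

Lemma Derive_nonneg_nondecreasing (a b : R) : 0 < a <= b -> M a <= M b.
Proof.
  intros [Ha Hab]; apply Rminus_le_0.
  apply (is_RInt_ge_0 (Derive M) a b); [exact Hab| |].
  - apply is_RInt_Derive_pos; lra.
  - intros u Hu; apply Derive_M_nonneg; lra.
Qed.

Lemma ex_RInt_exp_int (t a b : R) : 0 < a -> 0 < b ->
  ex_RInt (V := C_R_NormedModule)
    (fun u => Cmult (pow_mit t u) (RtoC (Derive M u))) a b.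
Proof.
  intros Ha Hb; pose proof (Rmin_glb_lt a b 0 Ha Hb) as Hmin.
  apply (ex_RInt_continuous (V := C_R_CompleteNormedModule)); intros u Hu.
  apply (continuous_ext (U := C_R_NormedModule)
    (fun u => scal (Derive M u) (pow_mit t u))).
  - intros v; rewrite Cmult_comm; apply scal_R_Cmult.
  - apply (continuous_scal (V := C_R_NormedModule)).
    + apply Derive_M_continuous; lra.
    + apply continuous_pow_mit; lra.
Qed.

Lemma exp_int_minus (t c a b : R) : 0 < c -> 0 < a -> 0 < b ->
  Cminus (exp_int M t c b) (exp_int M t c a) = exp_int M t a b.
Proof.
  intros Hc Ha Hb; unfold exp_int.
  rewrite <- (RInt_Chasles (V := C_R_CompleteNormedModule) _ c a b)
    by (apply ex_RInt_exp_int; assumption).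
  change plus with Cplus; ring.
Qed.

(** Multiplying the integrand by [a^(it)], of modulus 1, turns its phase at [u]
    into [t (ln u - ln a)], which lies in [[-1, 1]]. *)
Lemma Cmod_exp_int_ge (t a b : R) :
  0 < a <= b -> Rabs t * (b - a) <= a ->
  (M b - M a) / 2 <= Cmod (exp_int M t a b).
Proof.
  intros [Ha Hab] Hphase.
  apply (is_RInt_le_Cmod (fun u => Cmult (pow_mit t u) (RtoC (Derive M u)))
    (fun u => 1 / 2 * Derive M u) (pow_mit (- t) a) _ _ a b Hab).
  - apply Cmod_pow_mit.
  - apply (RInt_correct (V := C_R_CompleteNormedModule)), ex_RInt_exp_int; lra.
  - replace ((M b - M a) / 2) with (1 / 2 * (M b - M a)) by field.
    apply (is_RInt_scal (V := R_NormedModule)), is_RInt_Derive_pos; lra.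
  - intros u Hu; rewrite Re_pow_mit_rotation.
    apply Rmult_le_compat_r; [apply Derive_M_nonneg; lra|].
    apply cos_phase_ge_half; [lra|].
    apply Rle_trans with (2 := Hphase), Rmult_le_compat_l; [apply Rabs_pos|lra].
Qed.

Lemma LH_increment_le (n : nat -> nat) (e B : R) :
  increasing_pos n -> LH n M -> 0 < e -> 0 < B ->
  exists K, 0 <= K /\ forall (j : nat) (t x : R),
    INR (n j) <= x < INR (n (S j)) -> 0 < t -> t * (x - INR (n j)) <= INR (n j) ->
    x <= Rpower t B -> M x - M (INR (n j)) <= K * sqrt (M x) * Rpower t e.
Proof.
  intros Hn HLH He HB; destruct (HLH e B He HB) as [K HK].
  exists (4 * Rabs K); split; [pose proof (Rabs_pos K); lra|].
  intros j t x Hx Ht Hphase HxB; set (y := INR (n j)) in *.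
  pose proof (INR_increasing_pos_ge_1 n Hn 0) as H0.
  pose proof (INR_increasing_pos_le n Hn 0 j ltac:(lia)) as H0y; fold y in H0y.
  assert (HLHx : forall z, INR (n 0%nat) <= z <= x ->
    Cmod (Cminus (exp_sum n t z) (exp_int M t (INR (n 0%nat)) z)) <=
    Rabs K * sqrt (M x) * Rpower t e).
  { intros z Hz; specialize (HK t z); unfold rpow in HK.
    rewrite (Rabs_pos_eq t) in HK by lra.
    destruct (Rlt_dec 0 t) as [_|]; [|contradiction].
    apply Rle_trans with (1 := HK ltac:(lra)).
    apply Rmult_le_compat_r; [apply Rlt_le, exp_pos|].
    apply Rle_trans with (Rabs K * sqrt (M z)).
    - apply Rmult_le_compat_r; [apply sqrt_pos|apply Rle_abs].
    - apply Rmult_le_compat_l; [apply Rabs_pos|].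
      apply sqrt_le_1_alt, Derive_nonneg_nondecreasing; lra. }
  pose proof (HLHx x ltac:(lra)) as HLHgap; specialize (HLHx y ltac:(lra)).
  rewrite (exp_sum_between n Hn t x j Hx) in HLHgap; fold y in HLHgap.
  rewrite <- (Rabs_pos_eq t) in Hphase by lra.
  pose proof (Cmod_exp_int_ge t y x ltac:(lra) Hphase) as Hint.
  rewrite <- (exp_int_minus t (INR (n 0%nat))) in Hint by lra.
  set (E := exp_sum n t y) in *; set (I := exp_int M t _) in *.
  pose proof (Cmod_triangle (Cminus E (I y)) (Copp (Cminus E (I x)))) as Htri.
  replace (Cplus _ _) with (Cminus (I x) (I y)) in Htri by ring.
  rewrite Cmod_opp in Htri; lra.
Qed.

End ExponentialIntegral.

Lemma LH_id_increment_le (n : nat -> nat) (e B : R) :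
  increasing_pos n -> LH n (fun x => x) -> 0 < e -> 0 < B ->
  exists K, 0 <= K /\ forall (j : nat) (t h : R),
    0 <= h < gap n j -> 0 < t -> t * h <= INR (n j) ->
    INR (n j) + h <= Rpower t B -> h <= K * sqrt (INR (n j) + h) * Rpower t e.
Proof.
  intros Hn HLH He HB.
  destruct (LH_increment_le (fun x => x)) with (n := n) (e := e) (B := B)
    as [K [HK Hincr]]; [| | |assumption..|].
  - intros u _; apply ex_derive_id.
  - intros u _; apply (continuous_ext (fun _ => 1)); [|apply continuous_const].
    intros v; symmetry; apply Derive_id.
  - intros u _; rewrite Derive_id; lra.
  - exists K; split; [exact HK|]; unfold gap; intros j t h Hh Ht Hphase HtB.
    specialize (Hincr j t (INR (n j) + h)).
    replace (INR (n j) + h - INR (n j)) with h in Hincr by ring.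
    apply Hincr; lra.
Qed.

Lemma LH_long_gap_le (n : nat -> nat) (d : R) :
  increasing_pos n -> LH n (fun x => x) -> 0 < d < 1 / 2 ->
  exists K, forall j,
    2 <= INR (n j) -> Rpower (INR (n j)) (1 / 2 + d) < gap n j ->
    Rpower (INR (n j)) (1 / 2 + d) <= K * Rpower (INR (n j)) (1 / 2 + d / 2).
Proof.
  (* With [y = n_j], [h = y^(1/2+d)] and [t = y^(1/2-d)] we have [t h = y], and
     [B] is chosen so that [t^B = y^2 >= y + h]. *)
  intros Hn HLH Hd; set (B := 2 / (1 / 2 - d)).
  destruct (LH_id_increment_le n d B) as [K [HK Hincr]]; [assumption..|lra| |].
  { apply Rdiv_lt_0_compat; lra. }
  exists (2 * K); intros j; set (y := INR (n j)); intros Hy Hgap.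
  set (h := Rpower y (1 / 2 + d)) in *; set (t := Rpower y (1 / 2 - d)).
  assert (Hh : 0 < h <= y).
  { split; [apply exp_pos|].
    rewrite <- (Rpower_1 y) by lra; apply Rle_Rpower; lra. }
  assert (Hth : t * h = y).
  { unfold t, h; rewrite <- Rpower_plus.
    replace (_ + _) with 1 by field; apply Rpower_1; lra. }
  assert (HtB : y + h <= Rpower t B).
  { unfold t; rewrite Rpower_mult.
    replace ((1 / 2 - d) * B) with (1 + 1) by (unfold B; field; lra).
    rewrite Rpower_plus, Rpower_1 by lra; nra. }
  specialize (Hincr j t h ltac:(lra) (exp_pos _)); fold y in Hincr.
  apply Rle_trans with (1 := Hincr ltac:(lra) HtB).
  assert (Hsqrt : sqrt (y + h) <= 2 * Rpower y (/ 2)).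
  { rewrite Rpower_sqrt, <- (sqrt_square 2), <- sqrt_mult by lra.
    apply sqrt_le_1_alt; lra. }
  assert (Htd : Rpower t d <= Rpower y (d / 2)).
  { unfold t; rewrite Rpower_mult; apply Rle_Rpower; nra. }
  rewrite Rdiv_1_l, Rpower_plus.
  replace (2 * K * _) with (K * (2 * Rpower y (/ 2)) * Rpower y (d / 2)) by ring.
  apply Rmult_le_compat; [|apply Rlt_le, exp_pos| |exact Htd].
  - apply Rmult_le_pos; [exact HK|apply sqrt_pos].
  - apply Rmult_le_compat_l; [exact HK|exact Hsqrt].
Qed.

Lemma LH_gap_le (n : nat -> nat) (d : R) :
  increasing_pos n -> LH n (fun x => x) -> 0 < d < 1 / 2 ->
  exists x0, forall j,
    x0 <= INR (n j) -> gap n j <= Rpower (INR (n j)) (1 / 2 + d).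
Proof.
  intros Hn HLH Hd; destruct (LH_long_gap_le n d Hn HLH Hd) as [K HK].
  destruct (Rpower_eventually_gt (d / 2) K) as [y0 Hy0]; [lra|].
  exists (Rmax y0 2); intros j Hj; apply Rnot_lt_le; intros Hgap.
  specialize (HK j (Rle_trans _ _ _ (Rmax_r _ _) Hj) Hgap).
  specialize (Hy0 _ (Rle_trans _ _ _ (Rmax_l _ _) Hj)).
  set (y := INR (n j)) in *.
  replace (1 / 2 + d) with (d / 2 + (1 / 2 + d / 2)) in HK by field.
  rewrite Rpower_plus in HK.
  apply Rmult_le_reg_r in HK; [lra|apply exp_pos].
Qed.

Section Skipping.

Variable s : nat -> nat.
Hypothesis s_nondecreasing : forall j, (s j <= s (S j))%nat.

Definition skipping (j : nat) : nat := S (j + s j).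

Lemma INR_skipping (j : nat) : INR (skipping j) = INR j + 1 + INR (s j).
Proof. unfold skipping; rewrite S_INR, plus_INR; ring. Qed.

Lemma gap_skipping (j : nat) : gap skipping j = 1 + (INR (s (S j)) - INR (s j)).
Proof. unfold gap; rewrite !INR_skipping, S_INR; ring. Qed.

Lemma skipping_increasing : increasing_pos skipping.
Proof.
  unfold skipping; split; [lia|]; intros j; specialize (s_nondecreasing j); lia.
Qed.

Lemma counting_skipping_bounds (g : R -> R) (x : R) :
  (forall j y, (0 < j)%nat -> INR j <= y -> INR (s j) <= g y) ->
  INR (skipping 0) <= x ->
  counting skipping x <= x <= counting skipping x + 1 + g x.
Proof.
  intros Hg H0.
  destruct (increasing_pos_exists_between skipping skipping_increasing x H0)
    as [j Hj].
  rewrite (counting_between skipping skipping_increasing x j Hj).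
  rewrite !INR_skipping, S_INR in Hj; rewrite S_INR.
  pose proof (pos_INR (s j)) as Hs.
  specialize (Hg (S j) x ltac:(lia)); rewrite S_INR in Hg.
  specialize (Hg ltac:(lra)); lra.
Qed.

End Skipping.

Definition dyadic_floor (a : R) (j : nat) : nat :=
  Z.to_nat (Zfloor (Rpower (INR (2 ^ Nat.log2 j)) a)).

Lemma INR_pow2_ge_1 (k : nat) : 1 <= INR (2 ^ k).
Proof. apply (le_INR 1); pose proof (Nat.pow_nonzero 2 k); lia. Qed.

Lemma dyadic_floor_bounds (a : R) (j : nat) :
  INR (dyadic_floor a j) <= Rpower (INR (2 ^ Nat.log2 j)) a
    < INR (dyadic_floor a j) + 1.
Proof. apply INR_to_nat_Zfloor, Rlt_le, exp_pos. Qed.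

Lemma dyadic_floor_nondecreasing (a : R) (j : nat) : 0 <= a ->
  (dyadic_floor a j <= dyadic_floor a (S j))%nat.
Proof.
  intros Ha.
  assert (Hle : Rpower (INR (2 ^ Nat.log2 j)) a <=
    Rpower (INR (2 ^ Nat.log2 (S j))) a).
  { apply Rle_Rpower_l; [exact Ha|].
    pose proof (INR_pow2_ge_1 (Nat.log2 j)).
    split; [lra|]; apply le_INR, Nat.pow_le_mono_r, Nat.log2_le_mono; lia. }
  apply Zfloor_le in Hle; unfold dyadic_floor; lia.
Qed.

Lemma dyadic_floor_le_Rpower (a y : R) (j : nat) : 0 <= a ->
  (0 < j)%nat -> INR j <= y -> INR (dyadic_floor a j) <= Rpower y a.
Proof.
  intros Ha Hj Hy; destruct (dyadic_floor_bounds a j) as [H _].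
  apply Rle_trans with (1 := H), Rle_Rpower_l; [exact Ha|].
  pose proof (INR_pow2_ge_1 (Nat.log2 j)).
  destruct (Nat.log2_spec j Hj) as [Hlog _]; apply le_INR in Hlog; lra.
Qed.

Definition dyadic_gaps (a : R) : nat -> nat := skipping (dyadic_floor a).

Lemma dyadic_gaps_increasing (a : R) : 0 <= a -> increasing_pos (dyadic_gaps a).
Proof.
  intros Ha; apply skipping_increasing; intros j.
  apply dyadic_floor_nondecreasing, Ha.
Qed.

Lemma counting_dyadic_gaps (a x : R) : 0 <= a -> INR (dyadic_gaps a 0) <= x ->
  Rabs (counting (dyadic_gaps a) x - x) <= 2 * Rpower x a.
Proof.
  intros Ha Hx.
  pose proof (INR_increasing_pos_ge_1 _ (dyadic_gaps_increasing a Ha) 0) as H1.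
  destruct (counting_skipping_bounds (dyadic_floor a)) with
    (g := fun y => Rpower y a) (x := x) as [Hle Hge]; [| |exact Hx|].
  - intros j; apply dyadic_floor_nondecreasing, Ha.
  - intros j y; apply dyadic_floor_le_Rpower, Ha.
  - fold (dyadic_gaps a) in *.
    assert (Hxa : 1 <= Rpower x a).
    { rewrite <- (Rpower_O x) by lra; apply Rle_Rpower; lra. }
    apply Rabs_le; lra.
Qed.

Lemma gap_dyadic_gaps_before_pow2 (a : R) (m : nat) :
  (1 - Rpower 2 (- a)) * Rpower (INR (2 ^ S m)) a
    < gap (dyadic_gaps a) (Nat.pred (2 ^ S m)).
Proof.
  pose proof (INR_pow2_ge_1 m) as Hm.
  unfold dyadic_gaps.
  rewrite gap_skipping, Nat.succ_pred by (apply Nat.pow_nonzero; lia).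
  destruct (dyadic_floor_bounds a (2 ^ S m)) as [_ Hafter].
  destruct (dyadic_floor_bounds a (Nat.pred (2 ^ S m))) as [Hbefore _].
  rewrite Nat.log2_pow2 in Hafter by lia.
  rewrite Nat.log2_pred_pow2, Nat.pred_succ in Hbefore by lia.
  assert (Hhalf : Rpower 2 (- a) * Rpower (INR (2 ^ S m)) a =
    Rpower (INR (2 ^ m)) a).
  { rewrite Nat.pow_succ_r', mult_INR, <- Rpower_mult_distr by (simpl; lra).
    rewrite <- Rmult_assoc, Rpower_Ropp, Rinv_l; [ring|].
    apply Rgt_not_eq, exp_pos. }
  lra.
Qed.

Lemma dyadic_gaps_before_pow2_bounds (a : R) (m : nat) : 0 <= a <= 1 ->
  INR (2 ^ S m) <= INR (dyadic_gaps a (Nat.pred (2 ^ S m))) <= 2 * INR (2 ^ S m).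
Proof.
  intros Ha; pose proof (INR_pow2_ge_1 (S m)) as HP.
  assert (Hpred : INR (Nat.pred (2 ^ S m)) + 1 = INR (2 ^ S m)).
  { rewrite <- S_INR, Nat.succ_pred; [reflexivity|].
    apply Nat.pow_nonzero; lia. }
  unfold dyadic_gaps; rewrite INR_skipping, Hpred.
  set (P := INR (2 ^ S m)) in *; set (s := dyadic_floor a _).
  assert (Hs : INR s <= Rpower P a).
  { apply dyadic_floor_le_Rpower; [lra| |lra].
    pose proof (Nat.pow_gt_1 2 (S m)); lia. }
  assert (HPa : Rpower P a <= P).
  { rewrite <- (Rpower_1 P) at 2 by lra; apply Rle_Rpower; lra. }
  pose proof (pos_INR s); lra.
Qed.

Lemma dyadic_gaps_exists_long_gap (a b x0 : R) : 0 <= b < a -> a <= 1 ->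
  exists j, x0 <= INR (dyadic_gaps a j) /\
    Rpower (INR (dyadic_gaps a j)) b < gap (dyadic_gaps a) j.
Proof.
  intros Hb Ha; set (c := 1 - Rpower 2 (- a)).
  assert (Hc : 0 < c).
  { pose proof (Rpower_lt 2 (- a) 0) as H; rewrite Rpower_O in H by lra.
    specialize (H ltac:(lra) ltac:(lra)); unfold c; lra. }
  destruct (Rpower_eventually_gt (a - b) (2 / c)) as [y0 Hy0]; [lra|].
  destruct (INR_unbounded (Rmax x0 y0)) as [m Hm].
  pose proof (lt_INR _ _ (Nat.pow_gt_lin_r 2 (S m) ltac:(lia))) as Hpow.
  rewrite S_INR in Hpow.
  pose proof (Rmax_l x0 y0) as Hmax_l; pose proof (Rmax_r x0 y0) as Hmax_r.
  exists (Nat.pred (2 ^ S m)).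
  pose proof (gap_dyadic_gaps_before_pow2 a m) as Hgap; fold c in Hgap.
  pose proof (dyadic_gaps_before_pow2_bounds a m ltac:(lra)) as Hterm.
  pose proof (INR_pow2_ge_1 (S m)) as HP.
  set (y := INR (dyadic_gaps a _)) in *; set (P := INR (2 ^ S m)) in *.
  split; [lra|].
  apply Rle_lt_trans with (2 := Hgap).
  apply Rle_trans with (Rpower (2 * P) b); [apply Rle_Rpower_l; lra|].
  rewrite <- Rpower_mult_distr by lra.
  apply Rle_trans with (2 * Rpower P b).
  { apply Rmult_le_compat_r; [apply Rlt_le, exp_pos|].
    rewrite <- (Rpower_1 2) at 2 by lra; apply Rle_Rpower; lra. }
  replace a with ((a - b) + b) by ring.
  rewrite Rpower_plus, <- Rmult_assoc.
  apply Rmult_le_compat_r; [apply Rlt_le, exp_pos|].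
  specialize (Hy0 P ltac:(lra)); apply Rlt_div_l in Hy0; lra.
Qed.

Lemma not_LH_dyadic_gaps (a : R) : 1 / 2 < a < 1 ->
  ~ LH (dyadic_gaps a) (fun x => x).
Proof.
  intros Ha HLH; set (d := (a - 1 / 2) / 2).
  destruct (LH_gap_le (dyadic_gaps a) d) as [x0 Hshort];
    [apply dyadic_gaps_increasing; lra|exact HLH|unfold d; lra|].
  destruct (dyadic_gaps_exists_long_gap a (1 / 2 + d) x0) as [j [Hj Hlong]];
    [unfold d; lra|lra|].
  specialize (Hshort j Hj); lra.
Qed.

Theorem theorem2p1 (eps : R) (heps : 0 < eps) :
  exists n : nat -> nat,
    increasing_pos n /\
    (exists K x0 : R, forall x : R, x0 <= x ->
       Rabs (counting n x - x) <= K * rpow x (1 / 2 + eps)) /\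
    ~ LH n (fun x : R => x).
Proof.
  set (a := 1 / 2 + Rmin eps (1 / 4)).
  assert (Ha : 1 / 2 < a < 1).
  { pose proof (Rmin_glb_lt eps (1 / 4) 0); pose proof (Rmin_r eps (1 / 4)).
    unfold a; lra. }
  assert (Hle : a <= 1 / 2 + eps).
  { pose proof (Rmin_l eps (1 / 4)); unfold a; lra. }
  pose proof (dyadic_gaps_increasing a ltac:(lra)) as Hn.
  exists (dyadic_gaps a); split; [exact Hn|split].
  - exists 2, (INR (dyadic_gaps a 0)); intros x Hx.
    pose proof (INR_increasing_pos_ge_1 _ Hn 0) as H0.
    apply Rle_trans with (1 := counting_dyadic_gaps a x ltac:(lra) Hx).
    unfold rpow; destruct (Rlt_dec 0 x) as [_|Hx0]; [|lra].
    apply Rmult_le_compat_l; [lra|]; apply Rle_Rpower; lra.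
  - apply not_LH_dyadic_gaps, Ha.
Qed.
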